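(* Let $K$ be an arbitrary field and $R=K[x,y,z]$. Consider the ideal $I_{\alpha,\beta,\gamma,t}=(x^{\alpha+t},y^{\beta+t},z^{\gamma+t},x^\alpha y^\beta z^\gamma)$, where $\alpha,\beta,\gamma,t$ are integers with $1\le\alpha\le\beta\le\gamma$ and $t\ge 1$. Assume that one of the following three cases holds: (1) $(\alpha,\beta,\gamma,t)=(\alpha,\alpha,\alpha+3\lambda,t)$ with $\alpha$ even, $\lambda$ an odd integer, $t\ge\alpha+\lambda$ even, and $1\le\lambda\le\alpha$; (2) $(\alpha,\beta,\gamma,t)=(\alpha,\alpha,\alpha+6\mu,t)$ with $\alpha$ odd, $t\ge\alpha+2\mu$ even, and $\mu$ an integer with $0\le\mu\le\frac{\alpha-1}{2}$; or (3) $(\alpha,\beta,\gamma,t)=(\alpha,\alpha+3\rho,\alpha+3\rho,t)$ with $\alpha$ odd, $t\ge\alpha+2\rho$ even, and $\rho\ge 0$ an integer. Then $R/I_{\alpha,\beta,\gamma,t}$ fails to have the Weak Lefschetz property.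
   Context: A standard graded Artinian $K$-algebra $A$ has the Weak Lefschetz property (WLP) if there is a linear form $L\in A_1$ such that for all integers $j$ the multiplication map $\times L: A_{j-1}\to A_j$ has maximal rank, i.e. is injective or surjective. In cases (1)--(3), ''$t\ge\cdots$ even'' means that $t$ is an even integer satisfying the inequality. *)

(* Defs.v *)
From HB Require Import structures.
From mathcomp Require Import all_boot all_order all_algebra.
From mathcomp Require Import boolp classical_sets functions.
From mathcomp Require Import mpoly.

Set Implicit Arguments.
Unset Strict Implicit.
Unset Printing Implicit Defensive.

Import GRing.Theory.

Local Open Scope ring_scope.

(* The ideal (s_0, ..., s_(k-1)); membership is made boolean by excluded
   middle, as required by the quotient construction of ring_quotient.v. *)
Definition ideal_gen (R : comNzRingType) (s : seq R) : {pred R} :=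
  fun f => `[< exists c : 'I_(size s) -> R, f = \sum_(i < size s) c i * s`_i >].

(* ring_quotient.v only forms quotients by proper ideals, so the proof that
   the ideal is proper is an argument of the quotient ring. *)
Definition proper_ideal_gen (R : comNzRingType) (s : seq R)
  (s_proper : 1 \notin ideal_gen s) : {pred R} := ideal_gen s.

Section Quotient.
Variables (R : comNzRingType) (s : seq R) (s_proper : 1 \notin ideal_gen s).

Lemma proper_ideal_gen_closed : idealr_closed (proper_ideal_gen s_proper).
Proof.
split=> //.
  by apply/asboolP; exists (fun=> 0); rewrite big1 // => i _; rewrite mul0r.
move=> a u v /asboolP[c ->] /asboolP[d ->]; apply/asboolP.
exists (fun i => a * c i + d i).
by rewrite mulr_sumr -big_split; apply: eq_bigr => i _; rewrite mulrDl mulrA.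
Qed.

HB.instance Definition _ :=
  isIdealr.Build R (proper_ideal_gen s_proper) proper_ideal_gen_closed.

Definition quot_gen : comNzRingType := {ideal_quot proper_ideal_gen s_proper}.

Definition quot_gen_pi (f : R) : quot_gen :=
  \pi_{ideal_quot proper_ideal_gen s_proper}%qT f.

End Quotient.

Lemma ideal_gen_proper (K : fieldType) (n : nat) (s : seq {mpoly K[n]}) :
  all (fun g => g@_0%MM == 0) s -> 1 \notin ideal_gen s.
Proof.
move=> s0; apply/negP => /asboolP[c] /(congr1 (mcoeff 0%MM)).
rewrite mcoeff1 eqxx raddf_sum big1 => [/eqP|i _]; first by rewrite oner_eq0.
rewrite /= (mcoeff0_is_multiplicative _ _).1.
by rewrite (eqP (allP s0 _ (mem_nth _ (ltn_ord i)))) mulr0.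
Qed.

(* The degree j component of K[x_1, ..., x_n] / (s), for homogeneous s. *)
Definition quot_piece (K : fieldType) (n : nat) (s : seq {mpoly K[n]})
    (s_proper : 1 \notin ideal_gen s) (j : nat) : set (quot_gen s_proper) :=
  [set quot_gen_pi s_proper f | f in [set f | f \is j.-homog]]%classic.

Arguments quot_piece {K n s} s_proper j.

(* Weak Lefschetz property of the graded algebra A with components piece j.
   The maps A_(j-1) -> A_j with j <= 0 have zero source, hence are injective,
   and are left out. *)
Definition weak_lefschetz (A : comNzRingType) (piece : nat -> set A) : Prop :=
  exists2 L : A, piece 1%N L &
    forall j : nat, set_inj (piece j) ( *%R L)
                 \/ set_surj (piece j) (piece j.+1) ( *%R L).

(* Generators of the ideal, with x = 'X_0, y = 'X_1 and z = 'X_2. *)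
Definition aci_gens (K : fieldType) (alpha beta gamma t : nat) :
    seq {mpoly K[3]} :=
  [:: 'X_0 ^+ (alpha + t); 'X_1 ^+ (beta + t); 'X_2 ^+ (gamma + t);
      'X_0 ^+ alpha * 'X_1 ^+ beta * 'X_2 ^+ gamma].

Lemma aci_gens_proper (K : fieldType) (alpha beta gamma t : nat) :
  (0 < alpha)%N -> (0 < t)%N -> 1 \notin ideal_gen (aci_gens K alpha beta gamma t).
Proof.
move=> a_gt0 t_gt0; apply: ideal_gen_proper => /=.
have X0 (i : 'I_3) k : (0 < k)%N -> ('X_i ^+ k : {mpoly K[3]})@_0%MM = 0.
  case: k => // k _; rewrite exprS (mcoeff0_is_multiplicative _ _).1.
  by rewrite mcoeffX mnm1_eq0 mul0r.
have Xt0 (i : 'I_3) k : ('X_i ^+ (k + t) : {mpoly K[3]})@_0%MM = 0.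
  by rewrite X0 // addn_gt0 t_gt0 orbT.
by rewrite !(mcoeff0_is_multiplicative _ _).1 !Xt0 (X0 _ alpha) // !mul0r !eqxx.
Qed.

(* Main.v *)
(* Write 2p + q = 3e when the exponents (alpha, beta, gamma) are, up to order,
   (p, p, q); in all three cases e is odd, t is even, t > e and q <= 2e.  In
   degrees d = 2e + t - 2 and d + 1 the algebra has the same dimension, so
   there the Lefschetz property means that a square matrix M(L) is invertible.
   For L = x + y + z the swap of the two variables with equal exponents
   commutes with M(L).  Orbit sums span the invariants in any characteristic,
   and there is one more orbit of standard monomials in degree d than in
   degree d + 1, so M(x + y + z) kills a nonzero invariant.
   For the generic form with indeterminate coefficients, M differs from
   M(x + y + z) by diagonal matrices with monomial entries; its determinant
   therefore vanishes, and so does that of each specialization M(L),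
   including those where some coefficient of L is zero. *)
Require Import Defs.
From mathcomp Require Import all_boot all_order all_algebra.
From mathcomp Require Import boolp classical_sets functions.
From mathcomp Require Import mpoly.
From mathcomp Require Import fingroup perm.
From mathcomp Require Import zify.

Set Implicit Arguments.
Unset Strict Implicit.
Unset Printing Implicit Defensive.

Import GRing.Theory.

Local Open Scope ring_scope.

(** * Linear systems and determinants indexed by finite lists *)

Lemma seq_fun_of_row (F : nzRingType) (E : eqType) (x0 : E) (S : seq E)
    (v : 'rV[F]_(size S)) :
  uniq S -> exists f : E -> F, forall i : 'I_(size S), f (nth x0 S i) = v 0 i.
Proof.
move=> uS; exists (fun m => oapp (v 0) 0 (insub (index m S))) => i.
by rewrite index_uniq // valK.
Qed.

Lemma underdetermined_solution (F : fieldType) (E X : eqType) (S : seq E)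
    (C : seq X) (A : E -> X -> F) :
  uniq S -> (size C < size S)%N ->
  exists2 f : E -> F, (exists2 m, m \in S & f m != 0) &
    {in C, forall x, \sum_(m <- S) f m * A m x = 0}.
Proof.
move=> uS ltCS.
have [e0 _] : exists e0 : E, true by case: S ltCS {uS} => // e; exists e.
case: C ltCS => [|x0 C'] ltCS.
  exists (fun=> 1) => //; exists (nth e0 S 0); first exact: mem_nth.
  exact: oner_neq0.
move: (x0 :: C') ltCS => C ltCS.
pose M := \matrix_(i < size S, j < size C) A (nth e0 S i) (nth x0 C j).
have /rowV0Pn[v /sub_kermxP vM /rV0Pn[i0 vi0]] : kermx M != 0.
  rewrite kermx_eq0 /row_free neq_ltn (leq_ltn_trans _ ltCS) //.
  exact: rank_leq_col.
have [f fE] := seq_fun_of_row e0 v uS.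
exists f; first by exists (nth e0 S i0); [exact: mem_nth | rewrite fE].
move=> x /(nthP x0)[j ltj <-]; rewrite (big_nth e0) big_mkord.
move/matrixP/(_ 0 (Ordinal ltj)): vM; rewrite !mxE; apply: etrans.
by apply: eq_bigr => i _; rewrite fE mxE.
Qed.

(* Square by force: meaningful only when S and S' have the same size. *)
Definition seq_mx (F : nzRingType) (E : eqType) (x0 : E) (S S' : seq E)
    (A : E -> E -> F) : 'M[F]_(size S) :=
  \matrix_(i, j) A (nth x0 S i) (nth x0 S' j).

Lemma seq_mx_detP (F : idomainType) (E : eqType) (x0 : E) (S S' : seq E)
    (eqSS' : size S' = size S) (A : E -> E -> F) :
  uniq S ->
  reflect (exists2 f : E -> F, (exists2 m, m \in S & f m != 0) &
             {in S', forall m', \sum_(m <- S) f m * A m m' = 0})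
          (\det (seq_mx x0 S S' A) == 0).
Proof.
move=> uS; apply: (iffP det0P) => [[v /rV0Pn[i0 vi0] vM]|[f [m0 m0S fm0] fA]].
  have [f fE] := seq_fun_of_row x0 v uS.
  exists f; first by exists (nth x0 S i0); [exact: mem_nth | rewrite fE].
  move=> m' /(nthP x0)[j]; rewrite eqSS' => ltj <-.
  rewrite (big_nth x0) big_mkord.
  move/matrixP/(_ 0 (Ordinal ltj)): vM; rewrite !mxE; apply: etrans.
  by apply: eq_bigr => i _; rewrite fE mxE.
exists (\row_i f (nth x0 S i)).
  apply/rV0Pn; have /(nthP x0)[i lti im0] := m0S.
  by exists (Ordinal lti); rewrite mxE im0.
apply/rowP=> j; rewrite !mxE; apply: etrans (fA (nth x0 S' j) _);
  last by rewrite mem_nth ?eqSS'.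
rewrite [RHS](big_nth x0) big_mkord.
by apply: eq_bigr => i _; rewrite !mxE.
Qed.

Lemma det_seq_mx_tr (F : comNzRingType) (E : eqType) (x0 : E) (S S' : seq E)
    (A : E -> E -> F) :
  size S' = size S ->
  \det (seq_mx x0 S' S (fun m' m => A m m')) = \det (seq_mx x0 S S' A).
Proof.
move=> eqSS'; have -> : seq_mx x0 S' S (fun m' m => A m m') =
    castmx (esym eqSS', esym eqSS') (seq_mx x0 S S' A)^T.
  by apply/matrixP => i j; rewrite castmxE !mxE.
by case: _ / (esym eqSS'); rewrite castmx_id det_tr.
Qed.

(** A nonzero entry has m' = m + U_k, where X^m X_k = X^m'; hence [D S *m M] equals [M1] times
    [D S']. The polynomial ring is a domain and [\det (D S)] is a monomial, so [\det M] vanishes;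
    evaluating the variables at [l] is then legitimate even when some [l k] is zero. *)
Lemma det_linear_form_mx (F : fieldType) (n : nat) (S S' : seq 'X_{1..n})
    (l : 'I_n -> F) :
  \det (seq_mx 0%MM S S' (fun m m' => \sum_k (m' == m + U_(k))%MM%:R)) = 0 :> F ->
  \det (seq_mx 0%MM S S' (fun m m' => \sum_k l k *+ (m' == m + U_(k))%MM)) = 0.
Proof.
set M1 := seq_mx _ _ _ _ => detM1.
pose M : 'M[{mpoly F[n]}]_(size S) :=
  seq_mx 0%MM S S' (fun m m' => \sum_k 'X_k *+ (m' == m + U_(k))%MM).
pose D (T : seq 'X_{1..n}) : 'M[{mpoly F[n]}]_(size S) :=
  diag_mx (\row_i 'X_[nth 0%MM T i]).
have conj : D S *m M = map_mx (@mpolyC n F) M1 *m D S'.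
  apply/matrixP=> i j; rewrite mul_diag_mx mul_mx_diag !mxE.
  rewrite mulr_sumr rmorph_sum mulr_suml; apply: eq_bigr => k _ /=.
  case: eqP => [->|_]; last by rewrite mulr0n mulr0 rmorph0 mul0r.
  by rewrite rmorph1 mul1r mpolyXD.
have /eqP : \det (D S *m M) = 0.
  by rewrite conj det_mulmx det_map_mx detM1 rmorph0 mul0r.
rewrite det_mulmx mulf_eq0 det_diag => /orP[|/eqP detM].
  move/prodf_eq0 => [i _]; rewrite mxE => /eqP/(congr1 (mcoeff (nth 0%MM S i))).
  by rewrite mcoeffX eqxx mcoeff0 => /eqP; rewrite oner_eq0.
rewrite -[RHS](meval0 l) -detM -det_map_mx; congr (\det _).
apply/matrixP=> i j; rewrite !mxE rmorph_sum; apply: eq_bigr => k _.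
by rewrite rmorphMn /= mevalXU.
Qed.

(** * Kernel vectors invariant under swapping two variables *)

Definition mnm_swap (n : nat) (a b : 'I_n) (m : 'X_{1..n}) : 'X_{1..n} :=
  [multinom m (tperm a b i) | i < n].

(** Invariance is imposed by linear equations rather than by averaging, so the characteristic does
    not matter. *)
Lemma swap_invariant_kernel (F : fieldType) (n : nat) (a b : 'I_n)
    (S S' : seq 'X_{1..n}) :
  uniq S -> {in S, forall m, mnm_swap a b m \in S} ->
  {in S', forall m, mnm_swap a b m \in S'} ->
  (size [seq m : 'X_{1..n} <- S' | m a <= m b] <
     size [seq m : 'X_{1..n} <- S | m a <= m b])%N ->
  exists2 f : 'X_{1..n} -> F, (exists2 m, m \in S & f m != 0) &
    {in S', forall m',
       \sum_(m <- S) f m * \sum_k (m' == m + U_(k))%MM%:R = 0}.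
Proof.
move=> uS swS swS' ltS'S.
pose sw := @mnm_swap n a b.
have swK m : sw (sw m) = m by apply/mnmP=> i; rewrite !mnmE tpermK.
pose A m x : F := match x with
  | inl m' => \sum_k (m' == m + U_(k))%MM%:R
  | inr m0 => (m == m0)%:R - (m == sw m0)%:R
  end.
(* The unknowns are the values of [f] on [S]. There is one kernel equation per m' in the half m a <=
   m b of [S'], and one equation f m = f (sw m) per m outside that half of [S]; the hypothesis on
   sizes makes these fewer than the unknowns. *)
pose C := [seq inl m | m : 'X_{1..n} <- S' & (m a <= m b)%N] ++
          [seq inr m | m : 'X_{1..n} <- S & ~~ (m a <= m b)%N].
have ltCS : (size C < size S)%N.
  rewrite size_cat !size_map -(count_predC (fun m : 'X_{1..n} => m a <= m b)%N S).
  by rewrite !size_filter ltn_add2r -!size_filter.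
have [f f_neq0 fC] := underdetermined_solution A uS ltCS.
exists f => //.
have pick m0 : m0 \in S -> \sum_(m <- S) f m * (m == m0)%:R = f m0.
  move=> m0S; rewrite (bigD1_seq m0) //= eqxx mulr1 big1 ?addr0 // => m.
  by move/negPf->; rewrite mulr0.
have f_sw m : m \in S -> f (sw m) = f m.
  (* Invariance was imposed only where m b < m a. If m a < m b it is the equation at [sw m], and if
     m a = m b the swap fixes m. *)
  wlog nle_m : m / ~~ (m a <= m b)%N => [hw mS|mS].
    have [le_ab|/hw->//] := boolP (m a <= m b)%N.
    have [le_ba|nle_ba] := boolP (m b <= m a)%N.
      congr f; apply/mnmP=> i; rewrite mnmE.
      have eq_ab: m a = m b by apply/eqP; rewrite eqn_leq le_ab.
      by case: tpermP => [->|->|].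
    by rewrite -{2}(swK m) [RHS]hw ?swS // !mnmE tpermL tpermR.
  have /fC : inr m \in C.
    by rewrite mem_cat; apply/orP; right; rewrite map_f // mem_filter nle_m.
  rewrite /A; under eq_bigr do rewrite mulrBr.
  by rewrite sumrB !pick ?swS // => /eqP; rewrite subr_eq0 => /eqP.
move=> m' m'S'; have [le_ab|nle_ab] := boolP (m' a <= m' b)%N.
  by apply: (fC (inl m')); rewrite mem_cat map_f // mem_filter le_ab.
have /fC fsw : inl (sw m') \in C.
  rewrite mem_cat map_f // mem_filter swS' // andbT !mnmE tpermL tpermR.
  by rewrite ltnW // ltnNge.
(* The equation at m' turns into the one at [sw m'] when both [S] and the variables k are reindexed
   by the swap. *)
rewrite -[RHS]fsw.
have perm_sw : perm_eq S (map sw S).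
  apply: uniq_perm => // [|m]; first by rewrite (map_inj_uniq (can_inj swK)).
  apply/idP/mapP => [mS|[m1 m1S ->]]; last exact: swS.
  by exists (sw m); rewrite ?swK ?swS.
rewrite [RHS](perm_big _ perm_sw) big_map big_seq [RHS]big_seq.
apply: eq_bigr => m mS.
rewrite f_sw //; congr (_ * _) => /=.
rewrite (reindex_inj (@perm_inj _ (tperm a b))); apply: eq_bigr => k _.
congr (nat_of_bool _)%:R; apply/eqP/eqP => [->|/(congr1 sw)].
  by apply/mnmP=> i; rewrite !mnmE (inj_eq (@perm_inj _ (tperm a b))).
rewrite swK => ->; apply/mnmP=> i.
by rewrite !mnmE tpermK (can2_eq (tpermK a b) (tpermK a b)).
Qed.

(** * Monomial quotients and failure of the Lefschetz property *)

Lemma linear_formE (F : fieldType) (n : nat) (l : {mpoly F[n]}) :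
  l \is 1.-homog -> l = \sum_k l@_U_(k) *: 'X_k.
Proof.
move=> l1; apply/mpolyP=> u; rewrite raddf_sum /=.
have [/mdeg1P[k0 /eqP->]|u1] := boolP (mdeg u == 1%N).
  rewrite (bigD1 k0) //= mcoeffZ mcoeffXU eqxx mulr1 big1 ?addr0 // => k.
  by rewrite mcoeffZ mcoeffXU => /negPf->; rewrite mulr0.
rewrite (dhomog_nemf_coeff l1 u1) big1 // => k _.
rewrite mcoeffZ mcoeffX; case: eqP => [uk|_]; last by rewrite mulr0.
by rewrite -uk mdeg1 in u1.
Qed.

Lemma mcoeff_linear_formM (F : fieldType) (n : nat) (l : {mpoly F[n]}) m m' :
  l \is 1.-homog ->
  (l * 'X_[m])@_m' = \sum_k l@_U_(k) *+ (m' == m + U_(k))%MM.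
Proof.
move=> l1; rewrite {1}(linear_formE l1) mulr_suml raddf_sum.
apply: eq_bigr => k _ /=.
by rewrite -scalerAl mcoeffZ -mpolyXD mcoeffX addmC [_ == m']eq_sym mulr_natr.
Qed.

Definition mdivisible (n : nat) (exps : seq 'X_{1..n}) (m : 'X_{1..n}) : bool :=
  has (fun e => e <= m)%MM exps.

(** Their classes form a basis of the degree [d] component of the quotient. *)
Definition std_monomials (n : nat) (exps : seq 'X_{1..n}) (d : nat) :
    seq 'X_{1..n} :=
  [seq m : 'X_{1..n} <- [seq bmnm u | u <- enum {: 'X_{1..n < d.+1}}] |
     (mdeg m == d) && ~~ mdivisible exps m].

Lemma mem_std_monomials (n : nat) (exps : seq 'X_{1..n}) (d : nat) m :
  (m \in std_monomials exps d) = (mdeg m == d) && ~~ mdivisible exps m.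
Proof.
rewrite mem_filter; case: eqP => //= md; rewrite andbC.
suff -> : m \in [seq bmnm u | u <- enum {: 'X_{1..n < d.+1}}] by [].
have lt_m : (mdeg m < d.+1)%N by rewrite md.
by apply/mapP; exists (BMultinom lt_m); rewrite ?mem_enum.
Qed.

Lemma std_monomials_uniq (n : nat) (exps : seq 'X_{1..n}) (d : nat) :
  uniq (std_monomials exps d).
Proof. by rewrite filter_uniq // (map_inj_uniq val_inj) enum_uniq. Qed.

Lemma mem_monomial_ideal (F : fieldType) (n : nat) (exps : seq 'X_{1..n})
    (f : {mpoly F[n]}) :
  (f \in ideal_gen [seq 'X_[e] | e <- exps]) = all (mdivisible exps) (msupp f).
Proof.
set s := [seq 'X_[e] | e <- exps].
have sE (i : 'I_(size s)) : s`_i = 'X_[nth 0%MM exps i].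
  by rewrite (nth_map 0%MM) // -(size_map (fun e => 'X_[e] : {mpoly F[n]})).
apply/asboolP/allP => [[c ->] m|f_div].
  rewrite mcoeff_msupp raddf_sum /=; apply: contraNT => ndiv.
  apply/eqP/big1 => i _; apply/eqP; rewrite mcoeff_eq0 sE.
  apply: contra ndiv; rewrite (perm_mem (msuppMX _ _)) => /mapP[m' _ ->].
  apply/hasP; exists (nth 0%MM exps i); last exact: lem_addr.
  by rewrite mem_nth // -(size_map (fun e => 'X_[e] : {mpoly F[n]})).
(* Each monomial of [f] is charged to the first generator dividing it, so every term is counted
   exactly once. *)
pose ix m := find (fun e => e <= m)%MM exps.
exists (fun i : 'I_(size s) => \sum_(m <- msupp f | ix m == val i)
                   f@_m *: 'X_[m - nth 0%MM exps i]).
rewrite {1}[f]mpolyE; under [RHS]eq_bigr do rewrite big_mkcond mulr_suml.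
rewrite exchange_big /= big_seq [RHS]big_seq; apply: eq_bigr => m mf.
have lt_ix : (ix m < size s)%N by rewrite size_map -has_find; exact: f_div.
rewrite (bigD1 (Ordinal lt_ix)) // sE /= eqxx -scalerAl -mpolyXD submK; last first.
  exact: (@nth_find _ 0%MM (fun e => e <= m)%MM _ (f_div m mf)).
rewrite big1 ?addr0 // => i; rewrite -val_eqE eq_sym /= => /negPf->.
by rewrite mul0r.
Qed.

Lemma quot_gen_pi_eq (R : comNzRingType) (s : seq R)
    (s_proper : 1 \notin ideal_gen s) (f g : R) :
  (quot_gen_pi s_proper f == quot_gen_pi s_proper g) = (f - g \in ideal_gen s).
Proof. by rewrite /quot_gen_pi -Quotient.idealrBE. Qed.

Lemma quot_gen_piM (R : comNzRingType) (s : seq R)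
    (s_proper : 1 \notin ideal_gen s) (f g : R) :
  quot_gen_pi s_proper (f * g) = quot_gen_pi s_proper f * quot_gen_pi s_proper g.
Proof. exact: (rmorphM (\pi_{ideal_quot proper_ideal_gen s_proper}%qT)). Qed.

(** A singular square matrix has kernels on both sides: one gives a nonzero class of degree [d]
    killed by L, the other a nonzero functional on degree [d.+1] vanishing on the image of L. *)
Lemma monomial_not_weak_lefschetz (F : fieldType) (n : nat)
    (exps : seq 'X_{1..n})
    (s_proper : 1 \notin ideal_gen [seq 'X_[e] : {mpoly F[n]} | e <- exps])
    (d : nat) :
  let S := std_monomials exps d in
  let S' := std_monomials exps d.+1 in
  size S' = size S ->
  \det (seq_mx 0%MM S S' (fun m m' => \sum_k (m' == m + U_(k))%MM%:R)) = 0 :> F ->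
  ~ weak_lefschetz (quot_piece s_proper).
Proof.
move=> S S' eqSS' det1 [_ [l /= l1 <-] /(_ d)].
pose A (m m' : 'X_{1..n}) := \sum_k l@_U_(k) *+ (m' == m + U_(k))%MM.
have detA : \det (seq_mx 0%MM S S' A) == 0.
  by apply/eqP; exact: (@det_linear_form_mx _ _ _ _ (fun k => l@_U_(k))).
have uS : uniq S := std_monomials_uniq _ _.
have uS' : uniq S' := std_monomials_uniq _ _.
(* A multiple of a nonstandard monomial is nonstandard, so nonstandard terms of a representative do
   not affect the standard coordinates of the product. *)
have A_std m m' : m' \in S' -> mdeg m = d -> m \notin S -> A m m' = 0.
  rewrite !mem_std_monomials => /andP[_ ndiv'] -> /=; rewrite eqxx negbK => div.
  apply: big1 => k _; case: eqP => // m'E; case/negP: ndiv'; rewrite m'E.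
  have /hasP[e e_exps le_em] := div.
  by apply/hasP; exists e => //; apply: lepm_trans le_em (lem_addr _ _).
case=> [inj|surj].
- have [f [m0 m0S fm0] fA] := elimT (seq_mx_detP _ eqSS' _ uS) detA.
  pose p := \sum_(m <- S) f m *: 'X_[m].
  have p_d : p \is d.-homog.
    rewrite /p big_seq; apply: rpred_sum => m; rewrite mem_std_monomials.
    by case/andP=> md _; apply: dhomogZ; rewrite dhomogX.
  have p_m0 : p@_m0 = f m0.
    rewrite raddf_sum /= (bigD1_seq m0) //= mcoeffZ mcoeffX eqxx mulr1.
    by rewrite big1 ?addr0 // => m /negPf ne; rewrite mcoeffZ mcoeffX ne mulr0.
  suff : quot_gen_pi s_proper p == quot_gen_pi s_proper 0.
    rewrite quot_gen_pi_eq subr0 mem_monomial_ideal => /allP/(_ m0).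
    rewrite mcoeff_msupp p_m0 => /(_ fm0); apply/negP.
    by move: m0S; rewrite mem_std_monomials => /andP[].
  apply/eqP; apply: inj.
  + apply: mem_set; by exists p.
  + apply: mem_set; by exists 0 => //=; exact: dhomog0.
  apply/eqP; rewrite -!quot_gen_piM quot_gen_pi_eq mulr0 subr0 mem_monomial_ideal.
  apply/allP => m' lp_m'; apply: contraTT lp_m' => ndiv.
  rewrite mcoeff_msupp negbK; have lp_d := dhomogM l1 p_d.
  have [md|md] := eqVneq (mdeg m') d.+1; last first.
    by rewrite (dhomog_nemf_coeff lp_d) //= add1n.
  rewrite /p mulr_sumr raddf_sum /= -[X in _ == X](fA m').
    apply/eqP/eq_bigr => m _.
    by rewrite -scalerAr mcoeffZ mcoeff_linear_formM.
  by rewrite mem_std_monomials md eqxx.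
(* The functional [g] kills L times anything, but g m0 is nonzero; a preimage [h] of the class of
   X^m0 would give g m0 = g(l h) = 0. *)
- have /(seq_mx_detP _ (esym eqSS') _ uS')[g [m0 m0S' gm0] gA] :
      \det (seq_mx 0%MM S' S (fun m' m => A m m')) == 0.
    by rewrite det_seq_mx_tr.
  have [|_ [h /= h_d <-]] := surj (quot_gen_pi s_proper 'X_[m0]).
    exists 'X_[m0] => //=; rewrite dhomogX.
    by move: m0S'; rewrite mem_std_monomials => /andP[].
  rewrite -quot_gen_piM => /eqP; rewrite quot_gen_pi_eq mem_monomial_ideal.
  move=> /allP ideal_lh; case/eqP: gm0.
  have coef_lh m' : m' \in S' -> (l * h)@_m' = (m0 == m')%:R.
    move=> m'S'; apply/eqP; rewrite -subr_eq0 -mcoeffX -mcoeffB.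
    rewrite mcoeff_eq0; apply/negP => /ideal_lh; apply/negP.
    by move: m'S'; rewrite mem_std_monomials => /andP[].
  have -> : g m0 = \sum_(m' <- S') g m' * (l * h)@_m'.
    rewrite (bigD1_seq m0) //= coef_lh // eqxx mulr1 big_seq_cond big1 ?addr0 //.
    move=> m' /andP[m'S' ne]; rewrite coef_lh // eq_sym (negPf ne) mulr0 //.
  have lhE m' : (l * h)@_m' = \sum_(m <- msupp h) h@_m * A m m'.
    rewrite {1}[h]mpolyE mulr_sumr raddf_sum; apply: eq_bigr => m _ /=.
    by rewrite -scalerAr mcoeffZ mcoeff_linear_formM.
  under eq_bigr do rewrite lhE mulr_sumr.
  rewrite exchange_big /= big_seq big1 // => m mh.
  under eq_bigr do rewrite mulrCA; rewrite -mulr_sumr.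
  have [mS|mS] := boolP (m \in S); first by rewrite gA ?mulr0.
  rewrite big_seq big1 ?mulr0 // => m' m'S'.
  by rewrite A_std ?mulr0 //; exact: (dhomog_mf h_d mh).
Qed.

(** * Counting standard monomials in three variables *)

(* Exponents (p, p, q), e = 2u + 1 and t = 2v, so that d = 4u + 2v. *)
Section Counting.

Variables (u v p q : nat).
Hypotheses (pq_sum : (q + 2 * p = 6 * u + 3)%N) (le_q : (q <= 4 * u + 2)%N).
Hypothesis (lt_uv : (u < v)%N).

Definition std3 (d : nat) (w : nat * nat * nat) : bool :=
  let: (i, j, k) := w in
  [&& i + j + k == d, i < p + 2 * v, j < p + 2 * v, k < q + 2 * v
    & ~~ [&& p <= i, p <= j & q <= k]]%N.

(* Multiplication by the first variable, where the standard monomials with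
   nonstandard image are sent to the standard monomials of degree d + 1 not
   divisible by that variable. *)
Definition raise3 (w : nat * nat * nat) : nat * nat * nat :=
  let: (i, j, k) := w in
  if (i == p + 2 * v - 1)%N then
    (0, j + (4 * u + 2 - q), (4 * u + 2 * v).+1 - (j + (4 * u + 2 - q)))%N
  else if [&& i == p - 1, p <= j & q <= k]%N then
    (0, j + (2 * u + 1), (4 * u + 2 * v).+1 - (j + (2 * u + 1)))%N
  else (i.+1, j, k).

(** Inverse of [raise3] on standard monomials. For i = 0 the two exceptional families fill
    consecutive blocks, j from 4u+2-q to p+2u and from p+2u+1 to p+2v-1; the outer ends are exactly
    the bounds k < q+2v and j < p+2v. *)
Definition lower3 (w : nat * nat * nat) : nat * nat * nat :=
  let: (i, j, k) := w in
  if (0 < i)%N then (i.-1, j, k)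
  else if (j < p + (2 * u + 1))%N then
    (p + 2 * v - 1, j - (4 * u + 2 - q),
     4 * u + 1 - p - (j - (4 * u + 2 - q)))%N
  else (p - 1, j - (2 * u + 1), k + 2 * u + 1 - p)%N.

(* On monomials with i <= j: division by the first variable, where the
   monomials (0, j, k) fill up the part of the half i <= j that is left out,
   namely the (p - 1, j, k) with p <= j and q <= k and the diagonal (g, g, k).
   All of it is reached except top_diag3. *)
Definition lower_half3 (w : nat * nat * nat) : nat * nat * nat :=
  let: (i, j, k) := w in
  if (0 < i)%N then (i.-1, j, k)
  else if (p + (2 * u + 1) <= j)%N then
    (p - 1, j - (2 * u + 1), k + 2 * u + 1 - p)%N
  else let g := if (j + u < p + p)%N then (j + u - p)%N
                else (j + v - p - 1)%N in
  (g, g, 4 * u + 2 * v - 2 * g)%N.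

Lemma raise3_std w :
  std3 (4 * u + 2 * v) w -> std3 (4 * u + 2 * v).+1 (raise3 w).
Proof.
case: w => [[i j] k] /=; case: ifP => [|h1]; [|case: ifP => h2] => /=; lia.
Qed.

Lemma raise3K w : std3 (4 * u + 2 * v) w -> lower3 (raise3 w) = w.
Proof.
case: w => [[i j] k] /=; case: ifP => [h1|h1]; [|case: ifP => h2] => /= H.
- rewrite ifT; [congr (_, _, _)|]; lia.
- rewrite ifF; [congr (_, _, _)|]; lia.
- by [].
Qed.

Lemma lower3_std w :
  std3 (4 * u + 2 * v).+1 w -> std3 (4 * u + 2 * v) (lower3 w).
Proof.
case: w => [[i j] k] /=; case: ifP => [|h1]; [|case: ifP => h2] => /=; lia.
Qed.

Lemma lower3K w : std3 (4 * u + 2 * v).+1 w -> raise3 (lower3 w) = w.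
Proof.
case: w => [[i j] k] /=; case: ifP => [h1|h1]; [|case: ifP => h2] => /= H.
- rewrite ifF ?ifF; [congr (_, _, _)| |]; lia.
- rewrite ifT; [congr (_, _, _)|]; lia.
- rewrite ifF ?ifT; [congr (_, _, _)| |]; lia.
Qed.

Definition half3 (w : nat * nat * nat) : bool := (w.1.1 <= w.1.2)%N.

Definition top_diag3 : nat * nat * nat := (2 * u + v, 2 * u + v, 0)%N.

Lemma top_diag3_std : std3 (4 * u + 2 * v) top_diag3.
Proof. rewrite /=; lia. Qed.

(** A diagonal monomial (g, g, k) of degree 4u+2v is standard exactly for g in [p-u-1, p-1] or
    [p+v-u-1, 2u+v]. The remaining j, from 2p-2u-1 to p+2u, split at 2p-u and fill these two
    intervals except for the last value g = 2u+v. *)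
Lemma lower_half3_std w : std3 (4 * u + 2 * v).+1 w -> half3 w ->
  std3 (4 * u + 2 * v) (lower_half3 w) && half3 (lower_half3 w).
Proof.
rewrite /half3; case: w => [[i j] k] /=.
by case: ifP => h1 /=; [|case: ifP => h2 /=; [|case: ifP => h3 /=]] => ? ?; lia.
Qed.

(** The three kinds of image are disjoint: only the third lies on the diagonal, and a monomial (p-1,
    j, k) with p <= j and q <= k cannot be (i-1, j, k) with (i, j, k) standard. *)
Lemma lower_half3_inj w w' :
  std3 (4 * u + 2 * v).+1 w -> std3 (4 * u + 2 * v).+1 w' ->
  half3 w -> half3 w' -> lower_half3 w = lower_half3 w' -> w = w'.
Proof.
rewrite /half3; case: w w' => [[i j] k] [[i' j'] k'] /=.
case: ifP => h1 /=; [|case: ifP => h2 /=; [|case: ifP => h3 /=]];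
(case: ifP => h1' /=; [|case: ifP => h2' /=; [|case: ifP => h3' /=]]) => ? ? ? ? [] *;
 congr (_, _, _); lia.
Qed.

Lemma lower_half3_neq w : std3 (4 * u + 2 * v).+1 w -> half3 w ->
  lower_half3 w <> top_diag3.
Proof.
rewrite /half3; case: w => [[i j] k] /=.
by case: ifP => h1 /=; [|case: ifP => h2 /=; [|case: ifP => h3 /=]] => ? ? [] *; lia.
Qed.

End Counting.

(** * Transfer of the counts to multinomials in three variables *)

Lemma size_leq_inj (T T' : eqType) (s : seq T) (s' : seq T') (f : T -> T') :
  uniq s -> {in s &, injective f} -> {in s, forall x, f x \in s'} ->
  (size s <= size s')%N.
Proof.
move=> us injf fs; rewrite -(size_map f).
by apply: uniq_leq_size => [|_ /mapP[x xs ->]]; [rewrite map_inj_in_uniq | exact: fs].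
Qed.

Section Exponents.

Variables (a b c : 'I_3).
Hypothesis (abc_uniq : uniq [:: a; b; c]).

(** The order [a], [b], [c] is a parameter because the two equal exponents may belong to different
    pairs of variables. *)
Definition expo3 (m : 'X_{1..3}) : nat * nat * nat := (m a, m b, m c).

Definition mnm3 (w : nat * nat * nat) : 'X_{1..3} :=
  [multinom (if x == a then w.1.1 else if x == b then w.1.2 else w.2) | x < 3].

Lemma enum_abc : perm_eq (index_enum 'I_3) [:: a; b; c].
Proof.
apply: uniq_perm => // [|x]; first exact: index_enum_uniq.
rewrite mem_index_enum; apply/esym/negPn/negP => x_abc.
have /card_uniqP : uniq (x :: [:: a; b; c]) by rewrite cons_uniq x_abc.
by move: (max_card (mem (x :: [:: a; b; c]))) => /[swap] -> /=; rewrite card_ord.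
Qed.

Lemma expo3K : cancel expo3 mnm3.
Proof.
move=> m; apply/mnmP=> x; rewrite mnmE.
have : x \in [:: a; b; c] by rewrite -(perm_mem enum_abc) mem_index_enum.
rewrite !inE; case: eqP => [->//|_]; case: eqP => [->//|_] /= /eqP->.
by [].
Qed.

Lemma mnm3K : cancel mnm3 expo3.
Proof.
move=> [[i j] k]; rewrite /expo3 !mnmE /= eqxx.
move: abc_uniq; rewrite /= !inE negb_or andbT => /andP[/andP[ab ac] bc].
by rewrite !eqxx eq_sym (negPf ab) eq_sym (negPf ac) eq_sym (negPf bc).
Qed.

Lemma mdeg_expo3 m : mdeg m = (m a + m b + m c)%N.
Proof. by rewrite mdegE (perm_big _ enum_abc) !big_cons big_nil /= addn0 addnA. Qed.

Variables (u v p q : nat) (exps : seq 'X_{1..3}).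
Hypotheses (pq_sum : (q + 2 * p = 6 * u + 3)%N) (le_q : (q <= 4 * u + 2)%N).
Hypothesis (lt_uv : (u < v)%N).
Hypothesis expsE : forall m, mdivisible exps m =
  [|| p + 2 * v <= m a, p + 2 * v <= m b, q + 2 * v <= m c
    | [&& p <= m a, p <= m b & q <= m c]]%N.

Local Notation d := (4 * u + 2 * v)%N.

Lemma mem_std_expo3 k m :
  (m \in std_monomials exps k) = std3 v p q k (expo3 m).
Proof.
by rewrite mem_std_monomials expsE mdeg_expo3 /= !negb_or -!ltnNge.
Qed.

Lemma mem_std_mnm3 k w :
  (mnm3 w \in std_monomials exps k) = std3 v p q k w.
Proof. by rewrite mem_std_expo3 mnm3K. Qed.

Lemma size_std_monomials :
  size (std_monomials exps d.+1) = size (std_monomials exps d).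
Proof.
have transfer k k' (f g : nat * nat * nat -> nat * nat * nat) :
    (forall w, std3 v p q k w -> std3 v p q k' (f w)) ->
    (forall w, std3 v p q k w -> g (f w) = w) ->
    (size (std_monomials exps k) <= size (std_monomials exps k'))%N.
  move=> stdf fK; apply: (@size_leq_inj _ _ _ _ (mnm3 \o f \o expo3)).
  - exact: std_monomials_uniq.
  - apply: (@can_in_inj _ _ _ _ (mnm3 \o g \o expo3)) => m mS /=.
    by rewrite mnm3K fK -?mem_std_expo3 // expo3K.
  - by move=> m; rewrite mem_std_mnm3 mem_std_expo3; exact: stdf.
apply/eqP; rewrite eqn_leq; apply/andP; split.
- by apply: (transfer _ _ (lower3 u v p q) (raise3 u v p q)) => w;
    [apply: lower3_std | apply: lower3K].
- by apply: (transfer _ _ (raise3 u v p q) (lower3 u v p q)) => w;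
    [apply: raise3_std | apply: raise3K].
Qed.

Lemma size_half_std_monomials :
  (size [seq m : 'X_{1..3} <- std_monomials exps d.+1 | m a <= m b] <
   size [seq m : 'X_{1..3} <- std_monomials exps d | m a <= m b])%N.
Proof.
set H' := [seq _ <- _ | _]; set H := [seq _ <- _ | _].
have memH m : (m \in H) = std3 v p q d (expo3 m) && half3 (expo3 m).
  by rewrite mem_filter andbC mem_std_expo3.
have memH' m : (m \in H') = std3 v p q d.+1 (expo3 m) && half3 (expo3 m).
  by rewrite mem_filter andbC mem_std_expo3.
have uH : uniq H by exact: filter_uniq (std_monomials_uniq _ _).
have topH : mnm3 (top_diag3 u v) \in H.
  by rewrite memH mnm3K top_diag3_std //= /half3 leqnn.
(* Strictness comes from injecting into the half with the unreached monomial [top_diag3] removed. *)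
apply: (@leq_ltn_trans (size (rem (mnm3 (top_diag3 u v)) H))); last first.
  by rewrite size_rem // prednK // lt0n size_eq0; apply: contraTneq topH => ->.
apply: (@size_leq_inj _ _ _ _ (mnm3 \o lower_half3 u v p \o expo3)).
- exact: filter_uniq (std_monomials_uniq _ _).
- move=> m1 m2; rewrite !memH' => /andP[s1 h1] /andP[s2 h2] /= /(can_inj mnm3K).
  by move/(lower_half3_inj pq_sum le_q lt_uv s1 s2 h1 h2)/(can_inj expo3K).
- move=> m; rewrite memH' => /andP[sm hm].
  rewrite -[(_ \o _) m]/(mnm3 (lower_half3 u v p (expo3 m))).
  rewrite mem_rem_uniq // inE memH mnm3K
    (lower_half3_std pq_sum le_q lt_uv sm hm)
    andbT (can_eq mnm3K).
  exact/eqP/(lower_half3_neq pq_sum le_q lt_uv sm hm).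
Qed.

Lemma symmetric_not_weak_lefschetz (F : fieldType)
    (s_proper : 1 \notin ideal_gen [seq 'X_[e] : {mpoly F[3]} | e <- exps]) :
  ~ weak_lefschetz (quot_piece s_proper).
Proof.
apply: (@monomial_not_weak_lefschetz _ _ _ _ d); first exact: size_std_monomials.
apply/eqP/seq_mx_detP; [exact: size_std_monomials|exact: std_monomials_uniq|].
have sw_std k m : m \in std_monomials exps k ->
    mnm_swap a b m \in std_monomials exps k.
  have -> : mnm_swap a b m = mnm3 (m b, m a, m c).
    apply: (can_inj expo3K); rewrite mnm3K /expo3 !mnmE tpermL tpermR tpermD //.
      by move: abc_uniq; rewrite /= !inE negb_or => /and3P[/andP[]].
    by move: abc_uniq; rewrite /= !inE negb_or => /and3P[].
  rewrite mem_std_mnm3 mem_std_expo3 /=; lia.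
apply: (@swap_invariant_kernel _ _ a b).
- exact: std_monomials_uniq.
- by move=> m; exact: sw_std.
- by move=> m; exact: sw_std.
- exact: size_half_std_monomials.
Qed.

End Exponents.

(** * The ideal of the theorem and its three cases *)

Definition aci_exps (alpha beta gamma t : nat) : seq 'X_{1..3} :=
  [:: (U_(0%R) *+ (alpha + t))%MM; (U_(1%R) *+ (beta + t))%MM;
      (U_(2%R) *+ (gamma + t))%MM;
      (U_(0%R) *+ alpha + U_(1%R) *+ beta + U_(2%R) *+ gamma)%MM].

Lemma aci_gensE (K : fieldType) (alpha beta gamma t : nat) :
  aci_gens K alpha beta gamma t =
    [seq 'X_[e] | e <- aci_exps alpha beta gamma t].
Proof. by rewrite /= !mpolyXD -!mpolyXn. Qed.

Lemma mdivisible_aci (alpha beta gamma t : nat) m :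
  mdivisible (aci_exps alpha beta gamma t) m =
  [|| alpha + t <= m 0%R, beta + t <= m 1%R, gamma + t <= m 2%R
    | [&& alpha <= m 0%R, beta <= m 1%R & gamma <= m 2%R]]%N.
Proof.
have lem3 (e : 'X_{1..3}) :
    (e <= m)%MM = [&& e 0%R <= m 0%R, e 1%R <= m 1%R & e 2%R <= m 2%R]%N.
  apply/mnm_lepP/and3P => [le_em //|[e0 e1 e2] i].
  have : i \in [:: 0%R; 1; 2%R] by case: i => [[|[|[]]]].
  by rewrite !inE => /or3P[] /eqP->.
rewrite /mdivisible /= !lem3 !mnmE !mulmnE !mnm1E /=.
by rewrite !(muln0, muln1, mul0n, mul1n, addn0, add0n, leq0n, andbT, orbF).
Qed.

Local Close Scope ring_scope.
Unset Implicit Arguments.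

Theorem corollary7p4 (K : fieldType) (alpha beta gamma t : nat)
    (alpha_ge1 : 1 <= alpha) (le_alpha_beta : alpha <= beta)
    (le_beta_gamma : beta <= gamma) (t_ge1 : 1 <= t)
    (cases :
      (exists lambda : nat,
          [/\ beta = alpha, gamma = alpha + 3 * lambda, ~~ odd alpha,
              odd lambda & [/\ alpha + lambda <= t, ~~ odd t & 1 <= lambda <= alpha]])
      \/
      (exists mu : nat,
          [/\ beta = alpha, gamma = alpha + 6 * mu, odd alpha &
              [/\ alpha + 2 * mu <= t, ~~ odd t & mu <= (alpha - 1) %/ 2]])
      \/
      (exists rho : nat,
          [/\ beta = alpha + 3 * rho, gamma = alpha + 3 * rho, odd alpha,
              alpha + 2 * rho <= t & ~~ odd t])) :
  ~ weak_lefschetz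
      (quot_piece (aci_gens_proper K beta gamma alpha_ge1 t_ge1)).

Proof.
move: (aci_gens_proper _ _ _ _ _); rewrite aci_gensE => s_proper.
case: cases => [[l]|[[m]|[r]]].
(* Here e = alpha + l is odd with half [u], and q <= 2e amounts to l <= alpha. Parity turns e <= t
   into e < t, that is u < v. *)
- case=> beE gaE ev_a od_l [le_t ev_t /andP[_ le_l]].
  apply: (@symmetric_not_weak_lefschetz 0%R 1%R 2%R isT
            (alpha + l)./2 t./2 alpha gamma); try lia.
  by move=> m; rewrite mdivisible_aci; lia.
(* Here e = alpha + 2m, and q <= 2e amounts to 2m <= alpha. *)
- case=> beE gaE od_a [le_t ev_t le_m].
  apply: (@symmetric_not_weak_lefschetz 0%R 1%R 2%R isT
            (alpha + 2 * m)./2 t./2 alpha gamma); try lia.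
  by move=> m'; rewrite mdivisible_aci; lia.
(* The equal exponents now belong to y and z, with p = beta and q = alpha; e = alpha + 2r, so q <=
   2e is automatic. *)
- case=> beE gaE od_a le_t ev_t.
  apply: (@symmetric_not_weak_lefschetz 1%R 2%R 0%R isT
            (alpha + 2 * r)./2 t./2 beta alpha); try lia.
  by move=> m; rewrite mdivisible_aci; lia.
Qed.
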